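(* Let $D=(E,\mathcal{F})$ be a delta-matroid, $A\subseteq E$, and $\overline{A}=E-A$. Then $D*A$ has width one if and only if $A$ is a separator of $D_{\min}$, and one of $D|A$ and $D|\overline{A}$ is a matroid and the other has width one.
   Context: A delta-matroid $D=(E,\mathcal{F})$ consists of a finite set $E$ (the ground set) and a non-empty set $\mathcal{F}$ of subsets of $E$ (the feasible sets) satisfying the Symmetric Exchange Axiom: for all $X,Y\in\mathcal{F}$ and every $u\in X\triangle Y$ there is $v\in X\triangle Y$ (possibly $v=u$) with $X\triangle\{u,v\}\in\mathcal{F}$. Here $\triangle$ denotes symmetric difference. A matroid is a delta-matroid whose feasible sets all have the same size; its feasible sets are then its bases. The width of $D$ is $w(D)=\max_{F\in\mathcal{F}}|F|-\min_{F\in\mathcal{F}}|F|$. For $A\subseteq E$, the twist of $D$ with respect to $A$ is the delta-matroid $D*A=(E,\{A\triangle F: F\in\mathcal{F}\})$. $D_{\min}=(E,\mathcal{F}_{\min})$, where $\mathcal{F}_{\min}$ is the set of feasible sets of $D$ of minimum size; it is a matroid. For a matroid $M$ on $E$ with rank function $r$ ($r(X)$ is the size of the largest intersection of $X$ with a basis of $M$), a set $A\subseteq E$ is a separator of $M$ if $A$ is a union of components of $M$; equivalently $r(A)+r(E-A)=r(E)$. Both $\emptyset$ and $E$ are separators. Deletion and contraction: an element $e$ is a coloop of $D$ if it is in every feasible set and a loop if it is in no feasible set. If $e$ is not a coloop, $D\setminus e=(E-e,\{F: F\in\mathcal{F}, F\subseteq E-e\})$. If $e$ is not a loop, $D/e=(E-e,\{F-e: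 F\in\mathcal{F}, e\in F\})$. If $e$ is a loop or coloop, then $D/e=D\setminus e$. The result of a sequence of deletions and contractions does not depend on the order. The restriction $D|A$ is obtained from $D$ by deleting all elements of $E-A$. *)

(* Defs.v *)
From mathcomp Require Import all_boot.

Set Implicit Arguments.
Unset Strict Implicit.
Unset Printing Implicit Defensive.

Record set_system (T : finType) := SetSystem {
  ground : {set T};
  feasible : {set {set T}}
}.

Section DeltaMatroid.

Variable T : finType.
Implicit Types (D M : set_system T) (A C X Y F B : {set T}) (e f u v : T).

Definition symdiff X Y : {set T} := (X :\: Y) :|: (Y :\: X).

Definition symmetric_exchange D : Prop :=
  forall X Y, X \in feasible D -> Y \in feasible D ->
  forall u, u \in symdiff X Y ->
  exists2 v, v \in symdiff X Y & symdiff X [set u; v] \in feasible D.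

Definition is_delta_matroid D : Prop :=
  [/\ feasible D != set0,
      forall F, F \in feasible D -> F \subset ground D
    & symmetric_exchange D].

Definition is_matroid D : Prop :=
  is_delta_matroid D /\
  (forall X Y, X \in feasible D -> Y \in feasible D -> #|X| = #|Y|).

Definition max_size D : nat := \max_(F in feasible D) #|F|.

(* The default value [#|ground D|] does not affect the minimum, since feasible
   sets are contained in the ground set. *)
Definition min_size D : nat :=
  \big[minn/#|ground D|]_(F in feasible D) #|F|.

Definition width D : nat := max_size D - min_size D.

Definition twist D A : set_system T :=
  SetSystem (ground D) [set symdiff A F | F in feasible D].

Definition Dmin D : set_system T :=
  SetSystem (ground D) [set F in feasible D | #|F| == min_size D].

Definition coloop D e : bool :=
  (e \in ground D) && [forall F in feasible D, e \in F].
Definition loop D e : bool :=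
  (e \in ground D) && [forall F in feasible D, e \notin F].

(* An element cannot be both a loop and a coloop, as there is a feasible set.
   Hence [contract D e = delete D e] when [e] is a loop or a coloop. *)
Definition contract D e : set_system T :=
  SetSystem (ground D :\ e)
    (if loop D e then [set F in feasible D | F \subset ground D :\ e]
     else [set F :\ e | F in feasible D & e \in F]).

Definition delete D e : set_system T :=
  if coloop D e then contract D e
  else SetSystem (ground D :\ e)
         [set F in feasible D | F \subset ground D :\ e].

(* The elements are deleted in the order of [enum]; for a delta-matroid the
   result does not depend on the order. *)
Definition restrict D A : set_system T :=
  foldl delete D (enum (ground D :\: A)).

Definition independent M X : bool := [exists B in feasible M, X \subset B].

Definition circuit M C : bool :=
  minset (fun X => (X \subset ground M) && ~~ independent M X) C.

Definition share_circuit M : rel T := fun e f =>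
  [exists C, [&& circuit M C, e \in C & f \in C]].

(* [connect] takes the reflexive-transitive closure. In a matroid the relation
   "equal or in a common circuit" is already transitive, so the components are
   the usual ones. *)
Definition component M e : {set T} :=
  [set f in ground M | connect (share_circuit M) e f].

Definition components M : {set {set T}} := [set component M e | e in ground M].

Definition separator M A : Prop :=
  exists2 P : {set {set T}}, P \subset components M & A = cover P.

End DeltaMatroid.

(* Main.v *)
(* Write [a = #|F :&: A|] and [b = #|F :\: A|] for a feasible set [F].  The sizes
   in the twist are [#|A| + b - a], the feasible sets of [D|A] are the traces on
   [A] of the sets minimising [b], those of the other restriction are the traces
   of the sets minimising [a], and [A] is a separator of [Dmin] iff [a] is
   constant on the feasible sets of minimum size.  Hence both sides only concern
   the pairs [(a, b)], and symmetric exchange is used to slide a feasible set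
   towards the minimum of [a] (or of [b]) without decreasing [b - a] (or
   [a - b]).  Exchanging [A] with its complement reverses the sizes in the twist,
   which leaves one of the two alternatives to treat. *)

Require Import Defs.
From mathcomp Require Import all_boot order zify.

Set Implicit Arguments.
Unset Strict Implicit.
Unset Printing Implicit Defensive.

Import Order.TTheory.

Section Width.

Variable T : finType.
Implicit Types (D M : set_system T) (A C S X Y F G B : {set T}) (e f u v : T).

(** * Symmetric differences and sliding by exchange *)

Lemma in_symdiff X Y x : (x \in symdiff X Y) = (x \in X) (+) (x \in Y).
Proof. by rewrite !inE; case: (x \in X); case: (x \in Y). Qed.

Lemma card_symdiff X Y : #|symdiff X Y| = #|X :\: Y| + #|Y :\: X|.
Proof.
rewrite /symdiff cardsU [X in _ - #|pred_of_set X|](_ : _ = set0) ?cards0 ?subn0 //.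
by apply/setP=> x; rewrite !inE; case: (x \in X); case: (x \in Y).
Qed.

(** Written with sums on both sides because [b - a] may be negative, which subtraction on [nat]
    would truncate. *)
Lemma card_symdiff_add X F : #|symdiff X F| + #|F :&: X| = #|X| + #|F :\: X|.
Proof. by rewrite card_symdiff -(cardsID F X) setIC; lia. Qed.

Lemma symdiffA X Y Z : symdiff X (symdiff Y Z) = symdiff (symdiff X Y) Z.
Proof. by apply/setP=> x; rewrite !in_symdiff addbA. Qed.

(** Toggling [u] gains an element and toggling [v] loses at most one; for [v = u] only the gain
    remains. *)
Lemma leq_card_symdiff_pair X u v :
  u \notin X -> #|X| <= #|symdiff X [set u; v]|.
Proof.
move=> uX; apply: (@leq_trans #|(u |: X) :\ v|).
  have := cardsD1 v (u |: X); rewrite cardsU1 uX; case: (v \in _) => /=; lia.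
apply/subset_leq_card/subsetP=> x; rewrite in_symdiff !inE.
case/andP=> /negPf-> /orP[/eqP-> | xX]; first by rewrite (negPf uX) eqxx.
by rewrite xX orbF; case: eqP xX uX => // -> ->.
Qed.

(** Termination measure for repeated exchange towards [Y]: [u] leaves the difference, whether or not
    [v = u], and nothing enters it. *)
Lemma card_symdiff_pair_lt X Y u v :
  u \in symdiff X Y -> v \in symdiff X Y ->
  #|symdiff (symdiff X [set u; v]) Y| < #|symdiff X Y|.
Proof.
move=> uXY vXY; apply/proper_card/properP; split; last first.
  exists u => //; move: uXY; rewrite !in_symdiff !inE eqxx /=.
  by case: (u \in X); case: (u \in Y).
apply/subsetP=> x; move: uXY vXY; rewrite !in_symdiff in_set2.
case: (x =P u) => [->|_]; first by case: (u \in X); case: (u \in Y).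
case: (x =P v) => [->|_]; first by case: (v \in X); case: (v \in Y).
by rewrite addbF.
Qed.

(* Remove elements of [X] from [F] one by one by exchanging towards [F0]: each
   removal adds an element to [symdiff S F], and the exchange partner costs at
   most one. *)
Lemma exchange_descent D S X F F0 :
    is_delta_matroid D -> X \subset S -> F \in feasible D -> F0 \in feasible D ->
  exists F', [/\ F' \in feasible D, #|F' :&: X| <= #|F0 :&: X|
               & #|symdiff S F| <= #|symdiff S F'|].
Proof.
case=> _ _ symD sXS FD F0D.
have [n] := ubnP #|symdiff F F0|; elim: n F FD => // n IHn F FD le_n.
have [|/subsetPn[u]] := boolP (F :&: X \subset F0 :&: X).
  by move/subset_leq_card=> leF; exists F.
rewrite !inE => /andP[uF uX]; rewrite uX andbT => uF0.
have uFF0: u \in symdiff F F0 by rewrite in_symdiff uF (negPf uF0).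
have [v vFF0 F1D] := symD F F0 FD F0D u uFF0.
have := card_symdiff_pair_lt uFF0 vFF0 => lt1.
have [|F' [F'D leX leS]] := IHn _ F1D; first exact: leq_trans lt1 le_n.
exists F'; split=> //; apply: leq_trans leS.
rewrite symdiffA; apply: leq_card_symdiff_pair.
by rewrite in_symdiff uF (subsetP sXS).
Qed.


(** * Minimum size and width one *)

Lemma min_size_le D F : F \in feasible D -> min_size D <= #|F|.
Proof. by move=> FD; rewrite /min_size -minEnat -leEnat; apply: bigmin_inf FD _. Qed.

Lemma min_size_attained D :
    feasible D != set0 -> (forall F, F \in feasible D -> F \subset ground D) ->
  exists2 F, F \in feasible D & #|F| = min_size D.
Proof.
case/set0Pn=> F0 F0D subD; rewrite /min_size -minEnat.
rewrite (bigmin_eq_arg _ F0) //; last by move=> F /subD/subset_leq_card.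
by case: arg_minP => // F FD _; exists F.
Qed.

(** Trades the truncated difference of extremal sizes for bounds and witnesses, which suit linear
    arithmetic. *)
Lemma width1P D :
    feasible D != set0 -> (forall F, F \in feasible D -> F \subset ground D) ->
  width D = 1 <->
  exists k, [/\ forall F, F \in feasible D -> k <= #|F| <= k.+1,
                exists2 F, F \in feasible D & #|F| = k
              & exists2 F, F \in feasible D & #|F| = k.+1].
Proof.
move=> D0 subD; have [Fm FmD cFm] := min_size_attained D0 subD.
have [FM FMD cFM] : {F | F \in feasible D & max_size D = #|F|}.
  by apply: eq_bigmax_cond; rewrite card_gt0.
have leM F : F \in feasible D -> #|F| <= max_size D by exact: leq_bigmax_cond.
rewrite /width; split=> [w1 | [k [bnd [F1 F1D c1] [F2 F2D c2]]]].
  exists (min_size D); split; [|by exists Fm|by exists FM => //; lia].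
  by move=> F FD; have := leM _ FD; have := min_size_le FD; lia.
by have := bnd _ FmD; have := bnd _ FMD; have := leM _ F2D; have := min_size_le F1D; lia.
Qed.

(** * Deletion and restriction *)

Lemma delete_coloop D e :
    is_delta_matroid D -> coloop D e ->
  delete D e = SetSystem (ground D :\ e) [set F :\ e | F in feasible D].
Proof.
case=> /set0Pn[F0 F0D] _ _ ce; rewrite /delete ce /contract.
have/forall_inP eF := proj2 (andP ce).
have /negPf-> : ~~ loop D e.
  rewrite negb_and negb_forall; apply/orP; right; apply/existsP; exists F0.
  by rewrite negb_imply F0D negbK eF.
congr SetSystem; apply/setP=> Y; apply/imsetP/imsetP=> -[F].
  by rewrite inE => /andP[FD _] ->; exists F.
by move=> FD ->; exists F; rewrite // inE FD eF.
Qed.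

Lemma mem_delete_noncoloop D e F :
    is_delta_matroid D -> ~~ coloop D e ->
  (F \in feasible (delete D e)) = (F \in feasible D) && (e \notin F).
Proof.
case=> _ subD _ ne; rewrite /delete (negPf ne) inE subsetD1.
by case: (boolP (F \in _)) => //= /subD->.
Qed.

Lemma ground_delete D e : ground (delete D e) = ground D :\ e.
Proof. by rewrite /delete; case: ifP. Qed.

Lemma noncoloop_avoid D e :
  e \in ground D -> ~~ coloop D e -> exists2 F, F \in feasible D & e \notin F.
Proof.
move=> eD; rewrite /coloop eD /= negb_forall => /existsP[F].
by rewrite negb_imply => /andP[]; exists F.
Qed.

(** The sets that survive all agree on [e], so neither [u] nor its partner [v] is [e], and the
    exchange in [D] stays valid after the deletion. *)
Lemma is_delta_matroid_delete D e :
  is_delta_matroid D -> e \in ground D -> is_delta_matroid (delete D e).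
Proof.
move=> dD eD; have [D0 subD symD] := dD.
have [ce|ne] := boolP (coloop D e).
  have/forall_inP eF := proj2 (andP ce).
  rewrite delete_coloop //; split=> /=.
  - by case/set0Pn: D0 => F FD; apply/set0Pn; exists (F :\ e); apply: imset_f.
  - by move=> _ /imsetP[F FD ->]; apply/setSD/subD.
  move=> _ _ /imsetP[X XD ->] /imsetP[Y YD ->] u.
  have eqs : symdiff (X :\ e) (Y :\ e) = symdiff X Y.
    apply/setP=> x; rewrite !in_symdiff !inE; case: eqP => //= ->.
    by rewrite !eF.
  rewrite eqs => uXY; have [v vXY FD] := symD X Y XD YD u uXY.
  exists v => //; apply/imsetP; exists (symdiff X [set u; v]) => //.
  apply/setP=> x; rewrite !(in_symdiff, inE).
  case: (x =P e) => //= ->; apply/norP.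
  by split; apply/eqP=> ex; move: uXY vXY; rewrite -ex !in_symdiff !eF.
split.
- have [F FD eF] := noncoloop_avoid eD ne.
  by apply/set0Pn; exists F; rewrite mem_delete_noncoloop ?FD.
- move=> F; rewrite mem_delete_noncoloop // ground_delete subsetD1.
  by case/andP=> /subD-> ->.
move=> X Y; rewrite !mem_delete_noncoloop // => /andP[XD eX] /andP[YD eY] u uXY.
have [v vXY FD] := symD X Y XD YD u uXY; exists v => //.
rewrite mem_delete_noncoloop // FD in_symdiff !inE (negPf eX) /=; apply/norP.
by split; apply/eqP=> ex; move: uXY vXY;
   rewrite -ex !in_symdiff (negPf eX) (negPf eY).
Qed.

(* A minimum trace on [s] containing a non-coloop [e] can be rerouted: exchange
   [e] out; by minimality its partner is a new element of [s]. *)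
Lemma avoid_in_trace D e X F :
    is_delta_matroid D -> e \in ground D -> ~~ coloop D e -> e \in X ->
    F \in feasible D ->
  exists F', [/\ F' \in feasible D, e \notin F', #|F' :&: X| <= #|F :&: X|
    & (forall G, G \in feasible D -> #|F :&: X| <= #|G :&: X|) ->
      F' :\: X = F :\: X].
Proof.
move=> [_ _ symD] eD ne eX FD.
have [eF|eF] := boolP (e \in F); last by exists F.
have [Y YD eY] := noncoloop_avoid eD ne.
have eFY : e \in symdiff F Y by rewrite in_symdiff eF.
have [v vFY F'D] := symD F Y FD YD e eFY.
exists (symdiff F [set e; v]).
have sub : symdiff F [set e; v] :&: X \subset (v |: (F :&: X)) :\ e.
  apply/subsetP=> x; rewrite !(in_symdiff, inE).
  case: (x =P e) => [->|_]; first by rewrite eF.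
  by case: (x =P v) => [->|_] /=; [case: (v \in X); rewrite ?andbF | rewrite addbF].
have := cardsD1 e (v |: (F :&: X)); rewrite !inE eF eX orbT cardsU1 inE => cU.
have le := subset_leq_card sub.
split=> //.
- by rewrite eqxx.
- by move: cU le; clear; case: (~~ _) => /=; lia.
move=> minF; have := minF _ F'D => leF.
have vX : v \in X.
  apply/contraT=> vX; suff: #|symdiff F [set e; v] :&: X| < #|F :&: X| by rewrite ltnNge leF.
  apply/proper_card/properP; split; last first.
    by exists e; rewrite !inE ?eF ?eX // eqxx.
  apply/subsetP=> x xX; have := subsetP sub x xX; rewrite !inE => /andP[_].
  by case/orP=> // /eqP ev; move: xX; rewrite ev !inE (negPf vX) andbF.
apply/setP=> x; rewrite !(in_symdiff, inE).
case: (x =P e) => [->|_]; first by rewrite eX.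
by case: (x =P v) => [->|_]; rewrite ?vX // addbF.
Qed.

(** Induction on [s]: a coloop adds one to every trace, and a non-coloop can be avoided by a
    minimiser without changing its part outside the deleted set. *)
Lemma foldl_delete D (s : seq T) :
    is_delta_matroid D -> uniq s -> {subset s <= ground D} ->
  is_delta_matroid (foldl (@delete T) D s) /\
  (forall Y, Y \in feasible (foldl (@delete T) D s) <->
      exists2 F, F \in feasible D &
        (forall G, G \in feasible D -> #|F :&: [set x in s]| <= #|G :&: [set x in s]|)
        /\ Y = F :\: [set x in s]).
Proof.
elim: s D => [|e s IHs] D dD /=.
  move=> _ _; have -> : [set x in [::]] = set0 :> {set T} by apply/setP=> x; rewrite inE.
  split=> // Y; split=> [YD | [F FD [_ ->]]]; last by rewrite setD0.
  by exists Y => //; split=> [G|]; rewrite ?setI0 ?setD0.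
case/andP=> es us ssub; have eD : e \in ground D by apply: ssub; rewrite inE eqxx.
have sE : [set x in e :: s] = e |: [set x in s] by apply/setP=> x; rewrite !inE.
have := IHs _ (is_delta_matroid_delete dD eD) us.
rewrite ground_delete sE; case.
  move=> x xs; rewrite !inE ssub ?inE ?xs ?orbT // andbT.
  by apply: contraNneq es => <-.
set S := [set x in s] => dd memd; split=> // Y; rewrite memd.
have eS : e \notin S by rewrite inE.
have [ce|ne] := boolP (coloop D e).
  have/forall_inP eF := proj2 (andP ce).
  (* Every trace drops by exactly one, so the minimisers correspond. *)
  have cI F : F \in feasible D -> #|F :&: (e |: S)| = #|(F :\ e) :&: S|.+1.
    move=> FD; rewrite (cardsD1 e) !inE eF //= eqxx /= add1n; congr (#|pred_of_set _|.+1).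
    apply/setP=> x; rewrite !inE; case: (x =P e) => //= _.
  have dE F : (F :\ e) :\: S = F :\: (e |: S).
    by apply/setP=> x; rewrite !inE; case: (x == e); case: (x \in s).
  rewrite delete_coloop //; split.
    case=> _ /imsetP[F FD ->] [minF ->]; exists F => //; split=> // G GD.
    by rewrite !cI // ltnS; apply/minF/imset_f.
  case=> F FD [minF ->]; exists (F :\ e); first exact: imset_f.
  split=> // _ /imsetP[G GD ->]; have := minF G GD; by rewrite !cI // ltnS.
have eX : e \in e |: S by rewrite !inE eqxx.
have IE F : e \notin F -> F :&: (e |: S) = F :&: S.
  by move=> eF; apply/setP=> x; rewrite !inE; case: (x =P e) => // ->; rewrite (negPf eF).
have DE F : e \notin F -> F :\: (e |: S) = F :\: S.
  move=> eF; apply/setP=> x; rewrite !inE; case: (x =P e) => //= ->.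
  by rewrite (negPf eF) andbF.
split=> [[F] | [F FD [minF ->]]].
  rewrite mem_delete_noncoloop // => /andP[FD eF] [minF ->]; exists F => //.
  split=> [G GD|]; last by rewrite DE.
  (* [minF] compares only with sets avoiding [e]; rerouting [G] to [G'] extends it to all feasible
     sets. *)
  have [G' [G'D eG' leG _]] := avoid_in_trace dD eD ne eX GD.
  apply: leq_trans leG; rewrite !IE //; apply: minF.
  by rewrite mem_delete_noncoloop // G'D.
(* Conversely, the minimiser [F] is replaced by one that avoids [e] and has the same part outside
   [e |: S]. *)
have [F' [F'D eF' leF /(_ minF) eqF]] := avoid_in_trace dD eD ne eX FD.
exists F'; first by rewrite mem_delete_noncoloop // F'D.
split=> [G|]; last by rewrite -eqF DE.
rewrite mem_delete_noncoloop // => /andP[GD eG]; rewrite -!IE //.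
exact: leq_trans leF (minF G GD).
Qed.

Lemma restrictP D A :
    is_delta_matroid D ->
  is_delta_matroid (restrict D A) /\
  forall Y, Y \in feasible (restrict D A) <->
    exists2 F, F \in feasible D &
      (forall G, G \in feasible D -> #|F :\: A| <= #|G :\: A|) /\ Y = F :&: A.
Proof.
move=> dD; have [_ subD _] := dD.
have [|dR memR] := foldl_delete dD (enum_uniq (ground D :\: A)).
  by move=> x; rewrite mem_enum inE => /andP[].
split=> // Y; rewrite {}memR; set S := [set x in _].
have xS x : (x \in S) = (x \notin A) && (x \in ground D).
  by rewrite inE mem_enum inE.
have IE F : F \in feasible D -> F :&: S = F :\: A.
  move/subD/subsetP=> subF; apply/setP=> x; rewrite in_setI xS inE.
  by case: (boolP (x \in F)) => /= [/subF->|]; rewrite ?andbT ?andbF.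
have DE F : F \in feasible D -> F :\: S = F :&: A.
  move/subD/subsetP=> subF; apply/setP=> x; rewrite in_setD xS inE.
  by case: (boolP (x \in F)) => /= [/subF->|]; rewrite ?andbT ?andbF ?negbK.
split=> -[F FD [minF ->]]; exists F; rewrite ?DE //; split=> // G GD.
  by rewrite -!IE //; apply: minF.
by rewrite !IE //; apply: minF.
Qed.

(** * Separators, circuits and bases *)

(** Each component is a set of all elements reachable from a point, so the unions of components are
    the sets closed under single steps. *)
Lemma separator_closed M A :
  separator M A <->
  A \subset ground M /\ forall e f, e \in A -> share_circuit M e f -> f \in A.
Proof.
have circM e f : share_circuit M e f -> f \in ground M.
  by case/existsP=> C /and3P[/minsetp/andP[/subsetP CM _] _ /CM].
split=> [[P /subsetP sP ->] | [/subsetP AM clA]].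
  split=> [|e f /bigcupP[K KP eK] ef].
    by apply/bigcupsP=> K /sP/imsetP[e _ ->]; apply/subsetP=> x; rewrite inE => /andP[].
  apply/bigcupP; exists K => //; have /imsetP[g _ defK] := sP K KP.
  move: eK; rewrite defK !inE => /andP[_ ge]; rewrite (circM e) //=.
  exact: connect_trans ge (connect1 ef).
exists [set component M e | e in A].
  by apply/subsetP=> _ /imsetP[e /AM eM ->]; apply: imset_f.
apply/setP=> x; apply/idP/bigcupP=> [xA | [_ /imsetP[e eA ->]]].
  by exists (component M x); rewrite ?imset_f // inE connect0 AM.
rewrite inE => /andP[_ /connectP[p]].
elim: p e eA => [|f p IHp] e eA /=; first by move=> _ ->.
by case/andP=> /(clA _ _ eA) fA; apply: IHp.
Qed.

Lemma dependent_circuit M X :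
  X \subset ground M -> ~~ independent M X -> exists2 C, circuit M C & C \subset X.
Proof.
move=> XM nX; pose P Y := (Y \subset ground M) && ~~ independent M Y.
by have [|C minC CX] := @minset_exists _ P X _; [apply/andP | exists C].
Qed.

Lemma circuitD1_independent M C e :
  circuit M C -> e \in C -> independent M (C :\ e).
Proof.
move=> /minsetP[/andP[CM _] minC] eC; apply/contraT=> nC.
have CeC : C :\ e \subset C by exact: subD1set.
have := minC _ _ CeC; rewrite nC (subset_trans CeC CM) => /(_ isT) eqC.
by move: eC; rewrite -eqC !inE eqxx.
Qed.

Definition basis_exchange M : Prop :=
  forall B B' u, B \in feasible M -> B' \in feasible M -> u \in B -> u \notin B' ->
  exists v, [/\ v \in B', v \notin B & v |: (B :\ u) \in feasible M].

(** If [A] is closed, each basis exchange that removes an element of [A] also adds one. Conversely,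
    a circuit with [e] in [A] and [f] outside yields two bases whose traces on [A] differ in
    size. *)
Lemma separator_const M A :
    (forall B, B \in feasible M -> B \subset ground M) ->
    (forall B B', B \in feasible M -> B' \in feasible M -> #|B| = #|B'|) ->
    basis_exchange M ->
  separator M A <->
  A \subset ground M /\
  forall B B', B \in feasible M -> B' \in feasible M -> #|B :&: A| = #|B' :&: A|.
Proof.
move=> subM eqM exM; rewrite separator_closed; split=> -[AM clA]; split=> //.
  have leA B B' : B \in feasible M -> B' \in feasible M -> #|B :&: A| <= #|B' :&: A|.
    move=> BM B'M; have [n] := ubnP #|B :\: B'|; elim: n B BM => // n IHn B BM leBn.
    have [/subset_leq_card//|/subsetPn[u]] := boolP (B :&: A \subset B' :&: A).
    rewrite !inE => /andP[uB uA]; rewrite uA andbT => uB'.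
    have [v [vB' vB B1M]] := exM B B' u BM B'M uB uB'.
    have uv : u != v by apply: contraNneq vB => <-.
    (* A circuit inside [v |: B] contains [v] because [B] is a basis, and [u] because
       [v |: (B :\ u)] is one. *)
    have vA : v \in A.
      have nBv : ~~ independent M (v |: B).
        apply/existsP=> -[B2 /andP[B2M /subset_leq_card]].
        by rewrite cardsU1 vB (eqM B2 B) // ltnn.
      have vBM : v |: B \subset ground M.
        by rewrite subUset sub1set subM // (subsetP (subM _ B'M)).
      have [C circC /subsetP CvB] := dependent_circuit vBM nBv.
      have [_ /existsP nC] := andP (minsetp circC).
      apply: (clA u) => //; apply/existsP; exists C; rewrite circC /=.
      apply/andP; split; apply/contraT=> xC; case: nC.
        exists (v |: (B :\ u)); rewrite B1M; apply/subsetP=> x Cx.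
        move: (CvB x Cx); rewrite !inE; case: (x =P u) => // xu.
        by rewrite -xu Cx in xC.
      exists B; rewrite BM; apply/subsetP=> x Cx.
      move: (CvB x Cx); rewrite !inE; case: (x =P v) => // xv.
      by rewrite -xv Cx in xC.
    have -> : #|B :&: A| = #|(v |: (B :\ u)) :&: A|.
      have -> : (v |: (B :\ u)) :&: A = v |: ((B :&: A) :\ u).
        apply/setP=> x; rewrite !inE; case: (x =P v) => [->|_] /=; first by rewrite vA.
        by rewrite andbA.
      rewrite cardsU1 (cardsD1 u (B :&: A)) !inE uB uA (negPf vB) /=.
      by rewrite andbF.
    apply: IHn => //; apply: leq_trans (_ : _ < #|B :\: B'|) _; last by rewrite -ltnS.
    apply/proper_card/properP; split.
      apply/subsetP=> x; rewrite !inE => /andP[xB'].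
      by case: (x =P v) xB' => [->|_ ->] /=; [rewrite vB' | case/andP].
    by exists u; rewrite !inE ?uB ?uB' //= eqxx (negPf uv).
  by move=> B B' BM B'M; apply/eqP; rewrite eqn_leq !leA.
move=> e f eA /existsP[C /and3P[circC eC fC]]; apply/contraT=> fA.
have [CM nC] := andP (minsetp circC).
have /existsP[B /andP[BM /subsetP CfB]] := circuitD1_independent circC fC.
have /existsP[B0 /andP[B0M CeB0]] := circuitD1_independent circC eC.
have ef : e != f by apply: contraNneq fA => <-.
have eB : e \in B by apply: CfB; rewrite !inE ef.
have fB : f \notin B.
  apply: contra nC => fB; apply/existsP; exists B; rewrite BM; apply/subsetP=> x xC.
  by have [->//|xf] := eqVneq x f; apply: CfB; rewrite !inE xf.
(* Exchanging towards [B] turns [B0] into the basis [B + f - e]. *)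
have [B1 [B1M CeB1 B1B]] : exists B1, [/\ B1 \in feasible M, C :\ e \subset B1
    & B1 \subset f |: B].
  have [n] := ubnP #|B0 :\: B|; elim: n B0 B0M CeB0 => // n IHn B0 B0M CeB0 leB0n.
  have [|/subsetPn[g gB0]] := boolP (B0 \subset f |: B); first by exists B0.
  rewrite !inE negb_or => /andP[gf gB].
  have [h [hB hB0 B1M]] := exM B0 B g B0M BM gB0 gB.
  apply: (IHn (h |: (B0 :\ g))) => //.
    apply/subsetP=> x xCe; rewrite !inE (subsetP CeB0) // andbT.
    apply/orP; right; apply: contraNneq gB => xg; rewrite -xg; apply: CfB.
    by move: xCe; rewrite !inE xg gf => /andP[].
  apply: leq_trans (_ : _ < #|B0 :\: B|) _; last by rewrite -ltnS.
  apply/proper_card/properP; split.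
    apply/subsetP=> x; rewrite !inE => /andP[xB].
    by case: (x =P h) xB => [->|_ ->] /=; [rewrite hB | case/andP].
  exists g; rewrite !inE ?gB0 ?gB //= eqxx orbF.
  by apply: contraNneq gB => ->.
have eB1 : e \notin B1.
  apply: contra nC => eB1; apply/existsP; exists B1; rewrite B1M; apply/subsetP=> x xC.
  by have [->//|xe] := eqVneq x e; apply: (subsetP CeB1); rewrite !inE xe.
(* Passing from [B] to [B1] loses [e] from the trace and can add only [f], which is not in [A]. *)
suff: #|B1 :&: A| < #|B :&: A| by rewrite (clA B B1) ?ltnn.
apply/proper_card/properP; split; last by exists e; rewrite !inE ?eB ?eA ?(negPf eB1).
apply/subsetP=> x; rewrite !inE => /andP[xB1 xA]; rewrite xA andbT.
have := subsetP B1B x xB1; rewrite !inE => /orP[/eqP xf|//].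
by rewrite xf (negPf fA) in xA.
Qed.

(** A partner [v] in [B], in particular [v = u], would give a feasible set smaller than the minimum;
    hence [v] is new and the size is kept. *)
Lemma Dmin_basis_exchange D : is_delta_matroid D -> basis_exchange (Dmin D).
Proof.
case=> _ _ symD B B' u; rewrite !inE => /andP[BD /eqP cB] /andP[B'D /eqP cB'] uB uB'.
have uBB' : u \in symdiff B B' by rewrite in_symdiff uB (negPf uB').
have [v vBB' FD] := symD B B' BD B'D u uBB'.
have vB : v \notin B.
  apply/negP=> vB; have := min_size_le FD; rewrite leqNgt -cB => /negP; apply.
  apply/proper_card/properP; split; last by exists u; rewrite // in_symdiff uB !inE eqxx.
  apply/subsetP=> x; rewrite in_symdiff in_set2.
  by case: (x =P u) => [->|_] //; case: (x =P v) => [->|_] //; rewrite addbF.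
have eqF : v |: (B :\ u) = symdiff B [set u; v].
  apply/setP=> x; rewrite in_symdiff !inE.
  case: (x =P v) => [->|_] /=; first by rewrite (negPf vB) orbT.
  by case: (x =P u) => [->|_] /=; rewrite ?uB // addbF.
have cF : #|v |: (B :\ u)| = #|B|.
  by rewrite cardsU1 !inE (negPf vB) andbF [in RHS](cardsD1 u B) uB.
have vB' : v \in B' by move: vBB'; rewrite in_symdiff (negPf vB).
by exists v; split=> //; rewrite inE {1}eqF FD cF cB eqxx.
Qed.

Lemma separator_DminP D A : is_delta_matroid D -> A \subset ground D ->
  separator (Dmin D) A <->
  forall F G, F \in feasible D -> G \in feasible D -> #|F| = min_size D ->
    #|G| = min_size D -> #|F :&: A| = #|G :&: A|.
Proof.
move=> dD AD; have [_ subD _] := dD; rewrite separator_const //=.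
- split=> [[_ H] F G FD GD cF cG | H]; first by apply: H; rewrite inE ?FD ?GD ?cF ?cG eqxx.
  by split=> // F G; rewrite !inE => /andP[FD /eqP cF] /andP[GD /eqP cG]; apply: H.
- by move=> B; rewrite inE => /andP[/subD].
- by move=> B B'; rewrite !inE => /andP[_ /eqP->] /andP[_ /eqP->].
- exact: Dmin_basis_exchange.
Qed.

(** * Sizes in the twist and complementation *)

Lemma card_symdiffC A F : #|symdiff (~: A) F| + #|symdiff A F| = #|T|.
Proof.
rewrite -(cardsC (symdiff A F)) addnC; congr (_ + #|pred_of_set _|).
by apply/setP=> x; rewrite in_setC !in_symdiff in_setC addNb.
Qed.

(** The reversal of sizes relative to the ground set, for the twist by [ground D :\: A];
    [card_symdiffC] serves descents along [~: A]. *)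
Lemma card_symdiff_ground D A F : A \subset ground D -> F \subset ground D ->
  #|symdiff (ground D :\: A) F| + #|symdiff A F| = #|ground D|.
Proof.
move=> /subsetP AD /subsetP FD.
have sD : symdiff A F \subset ground D.
  by apply/subsetP=> x; rewrite in_symdiff; case: (boolP (x \in A)) => [/AD|_ /FD].
rewrite -(cardsID (symdiff A F) (ground D)) addnC (setIidPr sD).
congr (_ + #|pred_of_set _|); apply/setP=> x; rewrite in_setD !in_symdiff in_setD.
case: (boolP (x \in A)) => [/AD->|_]; first by case: (x \in F).
by case: (boolP (x \in F)) => [/FD->|_] //=; rewrite addbF.
Qed.

Lemma setD_ground D A F : F \subset ground D -> F :\: (ground D :\: A) = F :&: A.
Proof. by move=> FD; rewrite setDDr (eqP (_ : F :\: ground D == set0)) ?set0U ?setD_eq0. Qed.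

Lemma setI_ground D A F : F \subset ground D -> F :&: (ground D :\: A) = F :\: A.
Proof. by move=> FD; rewrite setIDA (setIidPl FD). Qed.

Lemma width1_twistP D A : is_delta_matroid D -> A \subset ground D ->
  width (twist D A) = 1 <->
  exists k, [/\ forall F, F \in feasible D -> k <= #|symdiff A F| <= k.+1,
                exists2 F, F \in feasible D & #|symdiff A F| = k
              & exists2 F, F \in feasible D & #|symdiff A F| = k.+1].
Proof.
case=> D0 subD _ /subsetP AD; rewrite width1P /=.
- split=> -[k [bnd [F1 F1D c1] [F2 F2D c2]]]; exists k; split.
  + by move=> F FD; apply/bnd/imset_f.
  + by case/imsetP: F1D c1 => F FD -> c1; exists F.
  + by case/imsetP: F2D c2 => F FD -> c2; exists F.
  + by move=> _ /imsetP[F FD ->]; apply: bnd.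
  + by exists (symdiff A F1) => //; apply: imset_f.
  + by exists (symdiff A F2) => //; apply: imset_f.
- by case/set0Pn: D0 => F FD; apply/set0Pn; exists (symdiff A F); apply: imset_f.
move=> _ /imsetP[F /subD/subsetP FD ->]; apply/subsetP=> x; rewrite in_symdiff.
by case: (boolP (x \in A)) => [/AD|_ /FD].
Qed.

Lemma width1_twist_ground D A : is_delta_matroid D -> A \subset ground D ->
  width (twist D A) = 1 -> width (twist D (ground D :\: A)) = 1.
Proof.
move=> dD AD; have [_ subD _] := dD; rewrite !width1_twistP ?subsetDl //.
case=> k [bnd [F1 F1D c1] [F2 F2D c2]].
have cE F : F \in feasible D -> _ := fun FD => card_symdiff_ground AD (subD F FD).
(* The largest size becomes the least, so [F1] and [F2] swap roles; [e2] ensures that the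
   subtraction is not truncated. *)
have := cE _ F2D => e2; exists (#|ground D| - k.+1); split.
- by move=> F FD; have := cE _ FD; have := bnd _ FD; clear -e2 c2; lia.
- by exists F2 => //; clear -e2 c2; lia.
by exists F1 => //; have := cE _ F1D; clear -e2 c2 c1; lia.
Qed.

(** * Restrictions in terms of traces *)

Lemma matroid_restrictP D A : is_delta_matroid D ->
  is_matroid (restrict D A) <->
  forall F G, F \in feasible D -> G \in feasible D ->
    (forall H, H \in feasible D -> #|F :\: A| <= #|H :\: A|) ->
    (forall H, H \in feasible D -> #|G :\: A| <= #|H :\: A|) ->
  #|F :&: A| = #|G :&: A|.
Proof.
move=> dD; have [dR memR] := restrictP A dD; split=> [[_ eqR] F G FD GD mF mG | eqD].
  by apply: eqR; apply/memR; [exists F | exists G].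
by split=> // X Y /memR[F FD [mF ->]] /memR[G GD [mG ->]]; apply: eqD.
Qed.

Lemma width1_restrictP D A : is_delta_matroid D ->
  width (restrict D A) = 1 <->
  exists k, [/\ forall F, F \in feasible D ->
                  (forall G, G \in feasible D -> #|F :\: A| <= #|G :\: A|) ->
                  k <= #|F :&: A| <= k.+1,
                exists F, [/\ F \in feasible D,
                  forall G, G \in feasible D -> #|F :\: A| <= #|G :\: A|
                  & #|F :&: A| = k]
              & exists F, [/\ F \in feasible D,
                  forall G, G \in feasible D -> #|F :\: A| <= #|G :\: A|
                  & #|F :&: A| = k.+1]].
Proof.
move=> dD; have [[R0 subR _] memR] := restrictP A dD; rewrite width1P //.
split=> [[k [bnd [_ /memR[F1 F1D [m1 ->]] c1] [_ /memR[F2 F2D [m2 ->]] c2]]] |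
         [k [bnd [F1 [F1D m1 c1]] [F2 [F2D m2 c2]]]]]; exists k; split.
- by move=> F FD mF; apply/bnd/memR; exists F.
- by exists F1.
- by exists F2.
- by move=> _ /memR[F FD [mF ->]]; apply: bnd.
- by exists (F1 :&: A) => //; apply/memR; exists F1.
- by exists (F2 :&: A) => //; apply/memR; exists F2.
Qed.

(** * The two implications *)

Lemma separator_of_width1_twist D A : is_delta_matroid D -> A \subset ground D ->
  width (twist D A) = 1 -> separator (Dmin D) A.
Proof.
move=> dD AD /(width1_twistP dD AD)[k [bnd _ _]].
apply/separator_DminP => // F G FD GD <- cG.
have := bnd _ FD; have := bnd _ GD.
have := card_symdiff_add A F; have := card_symdiff_add A G.
(* [b - a] takes two consecutive values and [a + b] is the same for both sets,
   so parity determines [a]. *)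
by have := cardsID A F; have := cardsID A G; clear -cG; lia.
Qed.

(** [F0] minimises both [a + b] and [b - a]. As [b - a] exceeds its minimum by at most one, [F0]
    also minimises [a] and [b] separately. *)
Lemma restrict_of_width1_twist D A k F0 :
    is_delta_matroid D -> A \subset ground D -> width (twist D A) = 1 ->
    (forall F, F \in feasible D -> k <= #|symdiff A F|) ->
    F0 \in feasible D -> #|F0| = min_size D -> #|symdiff A F0| = k ->
  is_matroid (restrict D A) /\ width (restrict D (ground D :\: A)) = 1.
Proof.
move=> dD AD /(width1_twistP dD AD)[l [bnd [F2 F2D c2] [F1 F1D c1]]] lek F0D m0 k0.
have [_ subD _] := dD.
have {}lek : l = k by move: (lek _ F2D) (bnd _ F0D); rewrite c2 k0; clear; lia.
rewrite {}lek {l} in bnd c1 c2; have s0 := card_symdiff_add A F0; have i0 := cardsID A F0.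
have key F : F \in feasible D ->
  [/\ #|F0 :&: A| <= #|F :&: A|, #|F0 :\: A| <= #|F :\: A|,
     #|F :&: A| + #|F0 :\: A| <= #|F0 :&: A| + #|F :\: A|
     & #|F0 :&: A| + #|F :\: A| <= (#|F :&: A| + #|F0 :\: A|).+1].
  move=> FD; have := min_size_le FD; have := bnd _ FD; rewrite -m0.
  have := card_symdiff_add A F; have := cardsID A F.
  by clear -s0 i0 k0; split; lia.
split.
  have aF F : F \in feasible D ->
      (forall H, H \in feasible D -> #|F :\: A| <= #|H :\: A|) ->
    #|F :&: A| = #|F0 :&: A|.
    move=> FD /(_ _ F0D) mF; have [] := key _ FD; clear -mF; lia.
  by apply/matroid_restrictP=> // F G FD GD mF mG; rewrite !aF.
apply/width1_restrictP=> //; exists #|F0 :\: A|.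
(* [F'] has minimum [a], while [b - a] is still at its upper value, so its [b] is one more than that
   of [F0]. *)
have [F' [F'D leX leS]] := exchange_descent dD (subxx A) F1D F0D.
have [le1 le2 le3 le4] := key _ F'D.
have eqI F : F \in feasible D -> #|F :\: (ground D :\: A)| = #|F :&: A|.
  by move=> FD; rewrite setD_ground ?subD.
have eqD F : F \in feasible D -> #|F :&: (ground D :\: A)| = #|F :\: A|.
  by move=> FD; rewrite setI_ground ?subD.
split.
- move=> F FD /(_ _ F0D); rewrite !eqI ?eqD //; have [] := key _ FD.
  by clear; lia.
- exists F0; split=> [//|G GD|]; last exact: eqD.
  by rewrite !eqI //; case: (key _ GD).
exists F'; split=> // [G GD|].
  by rewrite !eqI //; apply: leq_trans leX _; case: (key _ GD).
rewrite eqD //; have := card_symdiff_add A F'.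
by move: leX leS; rewrite c1; clear -le1 le2 le3 le4 k0 s0; lia.
Qed.

(** A minimum-size [F0] minimises both [a] and [b]. Any [F] can then be slid to minimum [b] or
    minimum [a], where the hypotheses on the restrictions bound [b - a] from below or above. *)
Lemma width1_twist_of_restrict D A : is_delta_matroid D -> A \subset ground D ->
    separator (Dmin D) A -> is_matroid (restrict D A) ->
    width (restrict D (ground D :\: A)) = 1 ->
  width (twist D A) = 1.
Proof.
move=> dD AD /(separator_DminP dD AD) sepA /(matroid_restrictP A dD) matA.
move=> /(width1_restrictP _ dD)[l [bnd [F2 [F2D m2 c2]] [F1 [F1D m1 c1]]]].
have [D0 subD _] := dD; have [F0 F0D c0] := min_size_attained D0 subD.
have eqI F : F \in feasible D -> #|F :\: (ground D :\: A)| = #|F :&: A|.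
  by move=> FD; rewrite setD_ground ?subD.
have eqD F : F \in feasible D -> #|F :&: (ground D :\: A)| = #|F :\: A|.
  by move=> FD; rewrite setI_ground ?subD.
have sF F := card_symdiff_add A F; have iF F := cardsID A F.
(* [symdiff setT] is complementation: a descent with [S = setT] never increases the size, so it
   stays among the minimum-size sets, where the separator fixes [a] and [b]. *)
have minF F : F \in feasible D -> #|symdiff setT F0| <= #|symdiff setT F| ->
    #|F :&: A| = #|F0 :&: A| /\ #|F :\: A| = #|F0 :\: A|.
  move=> FD; have := card_symdiff_add setT F; have := card_symdiff_add setT F0.
  rewrite !setDT cards0 !setIT => e0 eF le.
  have cF : #|F| = min_size D by have := min_size_le FD; clear -c0 e0 eF le; lia.
  have := sepA F F0 FD F0D cF c0; have := iF F; have := iF F0.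
  by clear -cF c0; lia.
have minb G : G \in feasible D -> #|F0 :\: A| <= #|G :\: A|.
  move=> GD; have [F' [F'D + /(minF _ F'D)[_ <-]]] :=
    exchange_descent dD (subsetT (~: A)) F0D GD.
  by rewrite -!setDE.
have mina G : G \in feasible D -> #|F0 :&: A| <= #|G :&: A|.
  by move=> GD; have [F' [F'D + /(minF _ F'D)[<- _]]] :=
    exchange_descent dD (subsetT A) F0D GD.
have aeq F : F \in feasible D -> #|F :\: A| <= #|F0 :\: A| -> #|F :&: A| = #|F0 :&: A|.
  move=> FD le; apply: matA => // G GD; exact: leq_trans le (minb G GD).
have beq F : F \in feasible D -> #|F :&: A| <= #|F0 :&: A| -> l <= #|F :\: A| <= l.+1.
  move=> FD le; rewrite -eqD //; apply: bnd => // G GD; rewrite !eqI //.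
  exact: leq_trans le (mina G GD).
have := m2 _ F0D; have := m1 _ F0D; rewrite !eqI // => a1 a2.
rewrite eqD // in c1; rewrite eqD // in c2.
(* [F2] attains [l], while [F0] has minimum [b] and satisfies the bound [l]. *)
have l0 : #|F0 :\: A| = l.
  by have := minb _ F2D; have := beq _ F0D (leqnn _); clear -c2; lia.
apply/width1_twistP=> //; exists #|symdiff A F0|; split.
- move=> F FD; apply/andP; split.
    (* Lower bound: lower [b] to its minimum without decreasing [a - b]; there [a] equals that of
       [F0]. *)
    have [F' [F'D leX leS]] := exchange_descent dD (subxx (~: A)) FD F0D.
    rewrite -!setDE in leX; have := aeq _ F'D leX; have := minb _ F'D.
    have := card_symdiffC A F; have := card_symdiffC A F'.
    by have := sF F'; have := sF F0; clear -leX leS; lia.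
  (* Upper bound: lower [a] to its minimum without decreasing [b - a]; there [b] is at most
     [l.+1]. *)
  have [F' [F'D leX leS]] := exchange_descent dD (subxx A) FD F0D.
  have := beq _ F'D leX; have := mina _ F'D.
  by have := sF F'; have := sF F0; clear -leX leS l0; lia.
- by exists F0.
exists F1 => //; have := mina _ F1D; have := sF F1; have := sF F0.
by clear -a1 c1 l0; lia.
Qed.

End Width.

Theorem theorem2p3 (T : finType) (D : set_system T) (A : {set T})
    (hD : is_delta_matroid D) (hA : A \subset ground D) :
  width (twist D A) = 1 <->
  separator (Dmin D) A /\
  ((is_matroid (restrict D A) /\ width (restrict D (ground D :\: A)) = 1) \/
   (is_matroid (restrict D (ground D :\: A)) /\ width (restrict D A) = 1)).
Proof.
have [D0 subD _] := hD.
have hAc : ground D :\: A \subset ground D by exact: subsetDl.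
have AcK : ground D :\: (ground D :\: A) = A by rewrite setD_ground // (setIidPr hA).
split=> [w1 | [sepA [[matA wAc] | [matAc wA]]]]; last first.
(* At fixed size, a constant trace on [A] forces a constant trace on the complement. *)
- have sepAc : separator (Dmin D) (ground D :\: A).
    apply/separator_DminP=> // F G FD GD cF cG.
    rewrite !setI_ground ?subD //.
    have := proj1 (separator_DminP hD hA) sepA F G FD GD cF cG.
    by have := cardsID A F; have := cardsID A G; clear -cF cG; lia.
  by rewrite -AcK; apply/width1_twist_ground/width1_twist_of_restrict; rewrite // AcK.
- exact: width1_twist_of_restrict.
split; first exact: separator_of_width1_twist.
have [F0 F0D c0] := min_size_attained D0 subD.
have [k [bnd _ _]] := proj1 (width1_twistP hD hA) w1.
(* The size of a minimum-size [F0] in the twist decides which alternative holds. *)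
have [k0|k1] : #|symdiff A F0| = k \/ #|symdiff A F0| = k.+1.
- by have := bnd _ F0D; clear; lia.
- left; apply: restrict_of_width1_twist k0 => // F FD.
  by case/andP: (bnd F FD).
(* Here [F0] has the largest size in the twist by [A], hence the least in the twist by the
   complement. *)
right; rewrite -{2}AcK.
apply: (restrict_of_width1_twist (F0 := F0)) erefl => //.
  exact: width1_twist_ground.
move=> F FD; have := card_symdiff_ground hA (subD _ FD).
have := card_symdiff_ground hA (subD _ F0D); have := bnd _ FD; clear -k1; lia.
Qed.
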